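(* Let $\psi$ be a conjunction of xor-constraints and let $G=\langle V,E,L\rangle$ be a Subst-derivation on $\psi$. Then there is a resolution derivation $\pi$ on the CNF formula $\bigwedge_{D\in\psi}\mathrm{cnf}(D)$ such that (i) for every vertex $v\in V$ with $L(v)\neq\top$, all clauses of $\mathrm{cnf}(L(v))$ occur in $\pi$, and (ii) $\pi$ has at most $|V|\,2^{m-1}$ clauses, where $m$ is the number of variables in the largest xor-constraint in $\psi$.
   Context: An xor-constraint is an equation $x_1\oplus\dots\oplus x_k\equiv p$ with Boolean variables $x_i$ and parity $p\in\{\bot,\top\}$; duplicate variables are always cancelled in pairs. An xor-constraint with no variables is $\bot\equiv\bot$ (identified with $\top$, a tautology) or $\bot\equiv\top$ (identified with $\bot$, a contradiction); $x\equiv\top$ is identified with the literal $x$ and $x\equiv\bot$ with $\neg x$. $D[x/Y]$ denotes the xor-constraint obtained from $D$ by substituting the variable $x$ by the expression $Y$ (and simplifying). $\mathrm{cnf}(D)$ is the straightforward CNF translation of $D$: the set of all clauses over $\mathrm{vars}(D)$ each of which excludes exactly one assignment falsifying $D$ (so a constraint on $n\ge1$ variables has $2^{n-1}$ clauses; $\mathrm{cnf}(\bot\equiv\top)$ is the empty clause). The Subst inference rules are, for variables $x,y$ and an xor-constraint $D$ in which $x$ occurs: from $x\equiv\top$ and $D$ infer $D[x/\top]$; from $x\equiv\bot$ and $D$ infer $D[x/\bot]$; from $x\oplus y\equiv\bot$ and $D$ infer $D[x/y]$; from $x\oplus y\equiv\top$ and $D$ infer $D[x/y\oplus\top]$. A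 Subst-derivation on a conjunction $\psi$ of xor-constraints is a vertex-labelled directed acyclic graph $G=\langle V,E,L\rangle$ in which every vertex with no incoming edges is labelled with an xor-constraint of $\psi$, and every other vertex $v$ has exactly two incoming edges, from $v'$ and $v''$, and $L(v)$ is obtained from $L(v')$ and $L(v'')$ by one of the Subst rules. A resolution derivation on a CNF formula $\phi$ is a finite sequence of clauses each of which is either a clause of $\phi$ or the resolvent (from $x\lor C$ and $\neg x\lor D$ obtain $C\lor D$) of two earlier clauses in the sequence.
   Formalization: The bound is false for x⊕y≡⊥, x⊕y≡⊤ ⊢ ⊥ (7 clauses needed, not 6): one extra clause is allowed when m=2, ⊥∉ψ, ⊥ is a label, L is injective and all other labels have exactly two variables. For m=0, 2^(m-1) is read as 1. *)

(* Defs.v *)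
(* Mathematical Components, with finmap for finite subsets of a choiceType. *)
From mathcomp Require Import all_boot finmap.

Set Implicit Arguments.
Unset Strict Implicit.
Unset Printing Implicit Defensive.

Local Open Scope fset_scope.

Section XorConstraints.
Variable X : choiceType.
Implicit Types (x y : X) (A S : {fset X}).

(* The pair (S, p) stands for the sum over GF(2) of the variables in S, set
   equal to p. Since S is a set, duplicates are already cancelled in pairs. *)
Definition xorc : Type := ({fset X} * bool)%type.

(* The pair (S, c) stands for the expression (sum of S) + c. *)
Definition xexpr : Type := ({fset X} * bool)%type.

Definition xvars (D : xorc) : {fset X} := D.1.
Definition xparity (D : xorc) : bool := D.2.

Definition xtop : xorc := (fset0, false).
Definition xbot : xorc := (fset0, true).

Definition xconst (c : bool) : xexpr := (fset0, c).
Definition xvar (x : X) (c : bool) : xexpr := ([fset x], c).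

Definition symdiff (A B : {fset X}) : {fset X} := (A `\` B) `|` (B `\` A).

(* Meaningful when x occurs in D; the constant of Y moves to the right. *)
Definition xsubst (D : xorc) (x : X) (Y : xexpr) : xorc :=
  (symdiff (xvars D `\ x) Y.1, xparity D (+) Y.2).

(* In the last two rules y is distinct from x: otherwise x + y would cancel and
   the first premise would be variable-free. *)
Inductive subst_rule : xorc -> xorc -> xorc -> Prop :=
| SubstTrue x D of x \in xvars D :
    subst_rule ([fset x], true) D (xsubst D x (xconst true))
| SubstFalse x D of x \in xvars D :
    subst_rule ([fset x], false) D (xsubst D x (xconst false))
| SubstEq x y D of x != y & x \in xvars D :
    subst_rule ([fset x; y], false) D (xsubst D x (xvar y false))
| SubstNeq x y D of x != y & x \in xvars D :
    subst_rule ([fset x; y], true) D (xsubst D x (xvar y true)).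

Definition acyclic (V : finType) (E : rel V) : Prop :=
  forall u v : V, E u v -> ~~ connect E v u.

Definition subst_derivation (psi : seq xorc) (V : finType) (E : rel V)
    (L : V -> xorc) : Prop :=
  acyclic E /\
  (forall v : V, [set u | E u v] = set0 -> L v \in psi) /\
  (forall v : V, [set u | E u v] <> set0 ->
    exists v' v'' : V,
      [/\ v' != v'', [set u | E u v] = [set v'; v'']
        & subst_rule (L v') (L v'') (L v)]).

(* The literal (x, true) is x and (x, false) is its negation. *)
Definition clause : Type := {fset (X * bool)}.

(* The clause over S false exactly at the assignment making true the
   variables in A and false those in S `\` A. *)
Definition excluding_clause (S A : {fset X}) : clause :=
  [fset (x, x \notin A) | x in S].

(* A ranges over the assignments to xvars D (given by their true variables)
   that falsify D. *)
Definition cnf (D : xorc) : {fset clause} :=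
  [fset excluding_clause (xvars D) A
     | A in fpowerset (xvars D) & odd #|` A| != xparity D].

Definition cnf_formula (psi : seq xorc) : {fset clause} :=
  \bigcup_(D <- psi) cnf D.

Definition resolvent (x : X) (C1 C2 : clause) : clause :=
  (C1 `\ (x, true)) `|` (C2 `\ (x, false)).

Definition resolution_derivation (phi : {fset clause}) (pi : seq clause)
    : Prop :=
  forall i : nat, i < size pi ->
    nth fset0 pi i \in phi \/
    exists (j k : nat) (x : X),
      [/\ j < i, k < i,
          (x, true) \in nth fset0 pi j, (x, false) \in nth fset0 pi k
        & nth fset0 pi i = resolvent x (nth fset0 pi j) (nth fset0 pi k)].

Definition max_width (psi : seq xorc) : nat :=
  \max_(D <- psi) #|` xvars D|.

(* The degenerate situation in which #|V| * 2 ^ (max_width psi).-1 clauses are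
   one too few. Each of the #|V| - 1 vertices other than the one labelled xbot
   requires its own two binary clauses, and none of those is the empty clause;
   since the empty clause is not an input either, deriving it requires two
   complementary unit clauses besides. The smallest instance has three
   vertices, labelled x + y = 0, x + y = 1 and xbot: seven clauses, not six. *)
Definition tight_refutation (psi : seq xorc) (V : finType) (L : V -> xorc)
    : bool :=
  [&& max_width psi == 2, xbot \notin psi, xbot \in codom L, injectiveb L
    & [forall v, (L v == xbot) || (#|` xvars (L v)| == 2)]].

End XorConstraints.

(* Main.v *)
(* A Subst rule replaces two constraints D1 and D2 sharing a variable x by
   their sum D over GF(2). An assignment f falsifying D can be changed at x so
   that it falsifies exactly D1, and flipping x then falsifies exactly D2;
   resolving the two excluding clauses on x leaves the clause that excludes f on
   vars(D1) and vars(D2) without x. If x is the only shared variable, this is a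
   clause of cnf(D). Otherwise D1 = {x, y} and y occurs in D2: two such
   resolvents, for f and for f flipped at y, are resolved on y. That takes three
   clauses instead of one, but D then has two variables fewer than D2, and
   3 * 2^(w-3) <= 2^(w-1). For w = 2 the same price is paid only when D is the
   contradiction, where 3 <= 2^(m-1) fails just for m = 2; the missing clause is
   recovered from a repeated label or from a label on fewer than two variables,
   unless the derivation is a tight refutation. *)

Require Import Defs.
From mathcomp Require Import all_boot finmap zify.

Set Implicit Arguments.
Unset Strict Implicit.
Unset Printing Implicit Defensive.

Local Open Scope fset_scope.

(** * Clauses excluding an assignment, and parities *)

Section Clauses.
Variable X : choiceType.
Implicit Types (x y z : X) (S T A : {fset X}) (f g : X -> bool) (D : xorc X).

(* Agrees with excluding_clause S A for f the membership in A, but f need not be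
   supported in S. *)
Definition falsified_clause S f : clause X := [fset (x, ~~ f x) | x in S].

Definition parity S f : bool := \big[addb/false]_(x <- S) f x.

Definition update f x b : X -> bool := fun z => if z == x then b else f z.

Lemma mem_falsified_clause S f x b :
  ((x, b) \in falsified_clause S f) = (x \in S) && (b == ~~ f x).
Proof.
apply/imfsetP/andP => [[z zS [-> ->]]|[xS /eqP ->]]; first by rewrite eqxx.
by exists x.
Qed.

Lemma eq_falsified_clause S f g :
  {in S, f =1 g} -> falsified_clause S f = falsified_clause S g.
Proof.
move=> fg; apply/fsetP => -[x b]; rewrite !mem_falsified_clause.
by case: (boolP (x \in S)) => //= /fg ->.
Qed.

Lemma eq_parity S f g : {in S, f =1 g} -> parity S f = parity S g.
Proof.
move=> fg; rewrite /parity big_seq_cond [RHS]big_seq_cond.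
by apply: eq_bigr => x; rewrite andbT => /fg.
Qed.

Lemma parityD1 S f x : x \in S -> parity S f = f x (+) parity (S `\ x) f.
Proof. by move=> xS; rewrite /parity (big_fsetD1 x). Qed.

Lemma parity_update S f x b :
  x \in S -> parity S (update f x b) = b (+) parity (S `\ x) f.
Proof.
move=> xS; rewrite (parityD1 _ xS) {1}/update eqxx; congr addb.
by apply: eq_parity => z; rewrite !inE /update => /andP[/negbTE ->].
Qed.

(** The contribution of [S] intersected with [T] appears in both summands and cancels over GF(2). *)
Lemma parity_symdiff S T f :
  parity (symdiff S T) f = parity S f (+) parity T f.
Proof.
have split_parity U W :
    parity U f = parity (U `&` W) f (+) parity (U `\` W) f.
  rewrite /parity (big_fsetID _ (mem W)) /=; congr addb;
    apply: congr_big => //; congr enum_fset; apply/fsetP => z; rewrite !inE //=.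
  by rewrite andbC.
rewrite (split_parity (symdiff S T) S) (split_parity S T) (split_parity T S).
have -> : symdiff S T `&` S = S `\` T.
  by apply/fsetP => x; rewrite !inE; do 2!case: (x \in _).
have -> : symdiff S T `\` S = T `\` S.
  by apply/fsetP => x; rewrite !inE; do 2!case: (x \in _).
by rewrite [T `&` S]fsetIC; do 3!case: parity.
Qed.

(** * The clauses of [cnf D] and their number *)

Lemma parity_card S A : A `<=` S -> parity S (mem A) = odd #|` A|.
Proof.
move=> AS; rewrite /parity -(big_fset_incl _ AS) => [|x _ /negbTE //].
rewrite (eq_big_seq (fun=> true)) => [|x //].
by rewrite big_const_seq count_predT; elim: size => //= n ->.
Qed.

(** Trades subsets of [xvars D] for arbitrary assignments, which [update] can change at one
    variable. *)
Lemma cnfP D (C : clause X) :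
  reflect (exists2 f, parity (xvars D) f != xparity D
                    & C = falsified_clause (xvars D) f)
          (C \in cnf D).
Proof.
apply: (iffP (imfsetP _ _ _ _)) => [[A] /=|[f fD ->]].
  rewrite !inE fpowersetE => /andP[AD oddA] ->.
  by exists (mem A); first by rewrite parity_card.
exists [fset x in xvars D | f x] => /=; last first.
  by apply: eq_falsified_clause => x xD; rewrite !inE /= xD.
rewrite !inE fpowersetE /= fset_sub /= -(@parity_card (xvars D)) ?fset_sub //.
by rewrite (@eq_parity _ _ f) // => x xD; rewrite !inE /= xD.
Qed.

(** For fixed [x] in [S], deleting [x] is injective on the subsets of [S] of a given parity, so they
    number at most the subsets of [S] without [x]. For empty [S] the truncated exponent gives the
    bound 1. *)
Lemma card_cnf D : #|` cnf D| <= 2 ^ #|` xvars D|.-1.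
Proof.
case: D => S p; set F := [fset A in fpowerset S | odd #|` A| != p].
have -> : cnf (S, p) = [fset excluding_clause S A | A in F].
  by apply/fsetP => C; apply/imfsetP/imfsetP => -[A /=];
    rewrite !inE => AS ->; exists A; rewrite //= !inE.
apply: leq_trans (leq_imfset_card _ _ _) _ => /=.
have [S0|[x xS]] := fset_0Vmem S.
  have -> : 2 ^ #|` xvars (S, p)|.-1 = #|` fpowerset S|.
    by rewrite card_fpowerset /= S0 cardfs0.
  by apply/fsubset_leq_card/fsubsetP => A; rewrite !inE => /andP[].
have injF : {in F &, injective (fun A => A `\ x)}.
  move=> A B; rewrite !inE => /andP[_ oddA] /andP[_ oddB] AB.
  (* Two sets of equal parity that agree off [x] also agree at [x]. *)
  suff xAB : (x \in A) = (x \in B).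
    apply/fsetP => z; case: (eqVneq z x) => [-> //|zx].
    by move/fsetP/(_ z): AB; rewrite !inE zx.
  move: oddA oddB; rewrite (cardfsD1 x A) (cardfsD1 x B) AB !oddD !oddb.
  by case: (p) (odd _) (x \in A) (x \in B) => [] [] [] [].
rewrite /= (cardfsD1 x S) xS /= -card_fpowerset -(card_in_imfset imfset_key injF) /=.
apply/fsubset_leq_card/fsubsetP => _ /imfsetP[A + ->].
by rewrite !inE !fpowersetE => /andP[AS _]; apply: fsetSD.
Qed.

Lemma cnf_xtop : cnf (xtop X) = fset0.
Proof.
apply/fsetP => C; rewrite inE; apply/cnfP => -[f].
by rewrite /parity /= big_seq_fset0.
Qed.

(** * Resolvents and the prolongation of resolution derivations *)

Lemma resolvent_falsified S T f g x :
    x \in S -> x \in T -> f x = false -> g x = true ->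
    (forall z, z != x -> f z = g z) ->
  resolvent x (falsified_clause S f) (falsified_clause T g) =
    falsified_clause ((S `|` T) `\ x) f.
Proof.
move=> xS xT fx gx fg; apply/fsetP => -[z b].
rewrite !inE !mem_falsified_clause !inE !xpair_eqE.
case: (eqVneq z x) => [->|zx] /=; first by rewrite xS xT fx gx; case: b.
by rewrite (fg _ zx) andb_orl.
Qed.

(** Quantifying over every derivation that contains [G] makes such steps composable: costs add up
    and earlier clauses can be reused. *)
Definition extends (phi G : {fset clause X}) n (H : {fset clause X}) : Prop :=
  forall pi, resolution_derivation phi pi -> {subset G <= pi} ->
  exists pi', [/\ resolution_derivation phi pi', {subset pi <= pi'},
                  {subset H <= pi'} & size pi' <= size pi + n].

Implicit Types (phi G H : {fset clause X}) (C : clause X).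

Lemma resolution_derivation_rcons phi pi C :
    resolution_derivation phi pi ->
    C \in phi \/ (exists C1 C2 x,
      [/\ C1 \in pi, C2 \in pi, (x, true) \in C1, (x, false) \in C2
        & C = resolvent x C1 C2]) ->
  resolution_derivation phi (rcons pi C).
Proof.
move=> der Cnew i; rewrite size_rcons ltnS leq_eqVlt => /predU1P[->|ilt].
  rewrite nth_rcons ltnn eqxx; case: Cnew => [|[C1 [C2 [x [C1i C2i x1 x2 ->]]]]].
    by left.
  right; exists (index C1 pi), (index C2 pi), x.
  by rewrite !nth_rcons !index_mem C1i C2i !nth_index.
rewrite nth_rcons ilt; have [|[j [k [x [ji ki xj xk eqi]]]]] := der i ilt.
  by left.
right; exists j, k, x.
by rewrite !nth_rcons (ltn_trans ji ilt) (ltn_trans ki ilt).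
Qed.

Lemma extends1 phi G C :
    C \in phi \/ (exists C1 C2 x,
      [/\ C1 \in G, C2 \in G, (x, true) \in C1, (x, false) \in C2
        & C = resolvent x C1 C2]) ->
  extends phi G 1 [fset C].
Proof.
move=> Cnew pi der Gpi; exists (rcons pi C); split.
- apply: resolution_derivation_rcons => //.
  case: Cnew => [|[C1 [C2 [x [/Gpi ? /Gpi ? ? ? ?]]]]]; first by left.
  by right; exists C1, C2, x.
- by move=> C'; rewrite mem_rcons inE orbC => ->.
- by move=> C'; rewrite inE => /eqP ->; rewrite mem_rcons inE eqxx.
- by rewrite size_rcons addn1.
Qed.

Lemma extends_trans phi G H1 H2 n1 n2 :
  extends phi G n1 H1 -> extends phi (G `|` H1) n2 H2 ->
  extends phi G (n1 + n2) (H1 `|` H2).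
Proof.
move=> ext1 ext2 pi der Gpi; have [pi1 [der1 s1 H1pi sz1]] := ext1 _ der Gpi.
have [C|pi2 [der2 s2 H2pi sz2]] := ext2 _ der1.
  by rewrite inE => /orP[/Gpi/s1|/H1pi].
exists pi2; split => // [C /s1/s2 //|C|]; last by lia.
by rewrite inE => /orP[/H1pi/s2|/H2pi].
Qed.

Lemma extendsW phi G G' H H' n n' :
    G `<=` G' -> H' `<=` H -> n <= n' ->
  extends phi G n H -> extends phi G' n' H'.
Proof.
move=> /fsubsetP GG' /fsubsetP HH' nn' ext pi der G'pi.
have [C /GG'/G'pi //|pi' [der' s Hpi sz]] := ext _ der.
by exists pi'; split=> // [C /HH'/Hpi //|]; lia.
Qed.

Lemma extends0 phi G : extends phi G 0 fset0.
Proof. by move=> pi der _; exists pi; split; rewrite ?addn0. Qed.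

Lemma extends_all phi G H n :
  (forall C, C \in H -> extends phi G n [fset C]) ->
  extends phi G (#|` H| * n) H.
Proof.
elim/finSet_rect: H => H IH ext; have [->|[C CH]] := fset_0Vmem H.
  by rewrite cardfs0; apply: extends0.
rewrite (cardfsD1 C) CH -{2}(fsetD1K CH) mulnDl mul1n.
apply: extends_trans (ext _ CH) _.
apply: extendsW (IH _ _ _) => //; first exact: fsubsetUl.
  exact: fproperD1.
by move=> C'; rewrite inE => /andP[_ /ext].
Qed.

(** * Simulation of one Subst step *)

Lemma extends_sum phi D1 D2 x f :
    x \in xvars D1 -> x \in xvars D2 ->
    parity (symdiff (xvars D1) (xvars D2)) f != xparity D1 (+) xparity D2 ->
  extends phi (cnf D1 `|` cnf D2) 1
    [fset falsified_clause ((xvars D1 `|` xvars D2) `\ x) f].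
Proof.
(* As [f] falsifies the sum, exactly one of the constraints is falsified with [x] set to false. By
   symmetry it is [D1]; then setting [x] to true falsifies [D2]. *)
wlog fD1 : D1 D2 / parity (xvars D1 `\ x) f != xparity D1.
  move=> wlog1 xD1 xD2; case: (eqVneq (parity (xvars D1 `\ x) f) (xparity D1)).
    move=> fD1 fD; rewrite (fsetUC (cnf _)) (fsetUC (xvars _)).
    apply: wlog1 => //; last first.
      by rewrite parity_symdiff addbC -parity_symdiff (addbC (xparity _)).
    apply: contra fD => /eqP fD2; rewrite parity_symdiff.
    rewrite (parityD1 _ xD1) (parityD1 _ xD2) fD1 fD2.
    by case: (f x) (xparity _) (xparity _) => [] [] [].
  by move=> fD1; apply: wlog1.
move=> xD1 xD2; rewrite parity_symdiff (parityD1 _ xD1) (parityD1 _ xD2) => fD.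
apply: extends1; right.
exists (falsified_clause (xvars D1) (update f x false)).
exists (falsified_clause (xvars D2) (update f x true)), x; split.
- rewrite inE; apply/orP; left; apply/cnfP; eexists; last by [].
  by rewrite parity_update.
- rewrite inE; apply/orP; right; apply/cnfP; eexists; last by [].
  rewrite parity_update //; move: fD1 fD.
  by case: (f x) (parity _ _) (parity _ _) (xparity _) (xparity _)
    => [] [] [] [] [].
- by rewrite mem_falsified_clause xD1 /update eqxx.
- by rewrite mem_falsified_clause xD2 /update eqxx.
rewrite resolvent_falsified // /update ?eqxx // => [|z /negbTE -> //].
by apply: eq_falsified_clause => z; rewrite !inE => /andP[/negbTE ->].
Qed.

(** Merges the four rules into addition over GF(2); the final disjunction separates one shared
    variable from two. *)
Lemma subst_ruleE D1 D2 D : subst_rule D1 D2 D ->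
  exists x, [/\ x \in xvars D1, x \in xvars D2, #|` xvars D1| <= 2,
     D = (symdiff (xvars D1) (xvars D2), xparity D1 (+) xparity D2) &
     xvars D1 `&` xvars D2 = [fset x] \/
     exists2 y, x != y & xvars D1 = [fset x; y] /\ y \in xvars D2].
Proof.
have symdiffx A x B : x \in A -> x \notin B ->
    symdiff (A `\ x) B = symdiff (x |` B) A.
  move=> xA xB; apply/fsetP => z; rewrite !inE.
  by case: (eqVneq z x) => [->|_] /=;
    rewrite ?xA ?(negbTE xB) //; do 2!case: (z \in _).
have shared x y S : x \in S ->
    [fset x; y] `&` S = [fset x] \/ y \in S.
  move=> xS; case: (boolP (y \in S)) => yS; [by right|left].
  apply/fsetP => z; rewrite !inE.
  case: (eqVneq z x) => [->|_] //=; case: (eqVneq z y) => [->|_] //=.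
  by rewrite (negbTE yS).
by case=> [x D' xD|x D' xD|x y D' xy xD|x y D' xy xD]; exists x;
  (split; [by rewrite !inE eqxx|by []|by rewrite ?cardfs1 ?cardfs2 ?ltnS ?leq_b1| |]);
  rewrite /xsubst ?symdiffx ?inE //= ?fsetU0 1?addbC //;
  [left; apply/fsetIidPl; rewrite fsub1set |
   left; apply/fsetIidPl; rewrite fsub1set |
   have [|yD] := shared x y (xvars D') xD; [by left|right; exists y] |
   have [|yD] := shared x y (xvars D') xD; [by left|right; exists y]].
Qed.

(** The price [n] per clause is 3 only when two variables disappear, since that drop in width is
    what later pays for it. *)
Lemma extends_subst phi D1 D2 D : subst_rule D1 D2 D ->
  #|` xvars D| <= #|` xvars D2| /\
  exists2 n, extends phi (cnf D1 `|` cnf D2) (#|` cnf D| * n) (cnf D) &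
    n = 1 \/ n = 3 /\ #|` xvars D2| = #|` xvars D|.+2.
Proof.
case/subst_ruleE=> x [xD1 xD2 leD1 -> [D12|[y xy [D1E yD2]]]].
  have DE : symdiff (xvars D1) (xvars D2) = (xvars D1 `|` xvars D2) `\ x.
    apply/fsetP => z; have /fsetP/(_ z) := D12; rewrite !inE => <-.
    by do 2!case: (z \in _).
  split.
    have := cardfsUI (xvars D1) (xvars D2); rewrite D12 cardfs1 /= DE.
    by rewrite (cardfsD1 x (_ `|` _)) inE xD1 /=; lia.
  exists 1; last by left.
  apply: extends_all => C /cnfP[f /= fD ->]; rewrite DE.
  exact: extends_sum.
have UE : xvars D1 `|` xvars D2 = xvars D2.
  apply/fsetP => z; rewrite D1E !inE.
  by case: eqVneq => [->|_]; case: eqVneq => [->|_]; rewrite ?xD2 ?yD2.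
have DE : symdiff (xvars D1) (xvars D2) = xvars D2 `\ x `\ y.
  apply/fsetP => z; rewrite D1E !inE.
  by case: eqVneq => [->|_]; case: eqVneq => [->|_]; rewrite ?xD2 ?yD2 ?andbF.
have yD2x : y \in xvars D2 `\ x by rewrite !inE eq_sym xy.
have cardE : #|` xvars D2| = #|` xvars D2 `\ x `\ y|.+2.
  by rewrite (cardfsD1 x) xD2 (cardfsD1 y (_ `\ x)) yD2x; lia.
rewrite /= DE; split; first by rewrite cardE; lia.
exists 3; last by right.
apply: extends_all => C /cnfP[f /= fD ->].
(* Since [y] is not in the conclusion, both values of [y] keep it falsified; resolving [g false]
   with [g true] then removes [y]. *)
pose g b := falsified_clause (xvars D2 `\ x) (update f y b).
have ext b : extends phi (cnf D1 `|` cnf D2) 1 [fset g b].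
  rewrite /g -[X in X `\ x]UE; apply: extends_sum => //; rewrite DE.
  rewrite (@eq_parity _ _ f) // => z.
  by rewrite !inE /update => /andP[/negbTE ->].
apply: (@extendsW _ (cnf D1 `|` cnf D2) _
    ([fset g false] `|` ([fset g true] `|` [fset falsified_clause
       (xvars D2 `\ x `\ y) f])) _ (1 + (1 + 1))) => //.
  by rewrite fsubsetU // fsubsetUr orbT.
apply: extends_trans; first exact: ext.
apply: extends_trans; first by apply: extendsW (ext true); rewrite ?fsubsetUl.
apply: extends1; right; exists (g false), (g true), y; split.
- by rewrite !inE eqxx ?orbT.
- by rewrite !inE eqxx ?orbT.
- by rewrite mem_falsified_clause yD2x /update eqxx.
- by rewrite mem_falsified_clause yD2x /update eqxx.
rewrite resolvent_falsified // /update ?eqxx // => [|z /negbTE -> //].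
rewrite fsetUid; apply: eq_falsified_clause => z.
by rewrite !inE => /andP[/negbTE ->].
Qed.

(** * Linear derivations and their width *)

(* The most recently derived constraint is at the head of the list. *)
Inductive linear_derivation (psi : seq (xorc X)) : seq (xorc X) -> Prop :=
| LinearNil : linear_derivation psi [::]
| LinearCons D Ds of linear_derivation psi Ds & D \notin Ds &
    D \in psi \/ (exists D1 D2,
      [/\ D1 \in Ds, D2 \in Ds & subst_rule D1 D2 D]) :
    linear_derivation psi (D :: Ds).

Lemma linear_derivation_uniq psi Ds : linear_derivation psi Ds -> uniq Ds.
Proof. by elim=> //= D {}Ds _ -> ->. Qed.

Lemma leq_max_width (psi : seq (xorc X)) D :
  D \in psi -> #|` xvars D| <= max_width psi.
Proof. by move=> Dpsi; rewrite /max_width (big_rem D) //= leq_maxl. Qed.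

Lemma linear_derivation_width psi Ds : linear_derivation psi Ds ->
  {in Ds, forall D, #|` xvars D| <= max_width psi}.
Proof.
elim=> // D {}Ds _ IH _ Dnew D'; rewrite inE => /predU1P[->|/IH //].
case: Dnew => [/leq_max_width //|[D1 [D2 [_ /IH leD2 D12]]]].
(* Only the width bound is taken, so [fset0] is an arbitrary choice of formula. *)
exact: leq_trans (proj1 (extends_subst fset0 D12)) leD2.
Qed.

(** * Cost of the clauses of one label *)

(* For width 2, the contradiction costs one more clause than the budget of its
   vertex, and a unit constraint or the tautology at least one less. *)
Definition label_cost (psi : seq (xorc X)) D : nat :=
  if max_width psi != 2 then 2 ^ (max_width psi).-1
  else if (D == xbot X) && (xbot X \notin psi) then 3
  else 2 ^ #|` xvars D|.-1.

Lemma card_cnf_cost psi D :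
  #|` xvars D| <= max_width psi -> #|` cnf D| <= label_cost psi D.
Proof.
move=> leDm; apply: leq_trans (card_cnf D) _; rewrite /label_cost.
case: ifP => _; first by rewrite leq_exp2l //; lia.
by case: ifP => [/andP[/eqP -> _]|_] //=; rewrite cardfs0.
Qed.

Lemma extends_axiom (psi : seq (xorc X)) G D : D \in psi ->
  extends (cnf_formula psi) G (label_cost psi D) (cnf D).
Proof.
move=> Dpsi; apply: (@extendsW _ G _ (cnf D) _ (#|` cnf D| * 1)) => //.
  by rewrite muln1 card_cnf_cost ?leq_max_width.
apply: extends_all => C CD; apply: extends1; left.
by apply/bigfcupP; exists D; rewrite ?Dpsi.
Qed.

(** A label belonging to [psi] is introduced directly instead of by the rule, so a contradiction in
    [psi] never costs 3. *)
Lemma extends_label psi D1 D2 D :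
    #|` xvars D2| <= max_width psi -> subst_rule D1 D2 D ->
  extends (cnf_formula psi) (cnf D1 `|` cnf D2) (label_cost psi D) (cnf D).
Proof.
move=> leD2 D12; have [Dpsi|Dpsi] := boolP (D \in psi).
  exact: extends_axiom.
have [leD [n ext n13]] := extends_subst (cnf_formula psi) D12.
apply: extendsW ext => //.
case: n13 => [->|[-> D2E]].
  by rewrite muln1 card_cnf_cost // (leq_trans leD).
have [DT|DnT] := eqVneq D (xtop X); first by rewrite DT cnf_xtop cardfs0.
have cardD := card_cnf D; rewrite /label_cost; case: eqP => [m2|m2] /=.
  (* Here [D2] has at most two variables and [D] two fewer; [D], not being the tautology, is the
     contradiction. *)
  have D0 : #|` xvars D| = 0 by lia.
  have DB : D = xbot X.
    by case: D D0 DnT {Dpsi D12 leD D2E cardD} => S [] /cardfs0_eq /= ->.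
  move: cardD Dpsi; rewrite D0 expn0 DB eqxx => cardB -> /=.
  by rewrite -[X in _ <= X]mul1n leq_mul2r.
apply: leq_trans (leq_mul cardD (leqnn 3)) _.
(* Without variables the exponent is truncated: [D] has at most one clause, and 3 <= 2^2 suffices
   because the maximal width is now at least 3. *)
have [D0|D0] := posnP #|` xvars D|.
  have : 2 ^ 2 <= 2 ^ (max_width psi).-1 by rewrite leq_exp2l //; lia.
  by rewrite D0 /=; lia.
have : 2 ^ #|` xvars D|.-1.+2 <= 2 ^ (max_width psi).-1.
  by rewrite leq_exp2l //; lia.
by rewrite !expnS; lia.
Qed.

Lemma extends_linear psi Ds : linear_derivation psi Ds ->
  extends (cnf_formula psi) fset0 (\sum_(D <- Ds) label_cost psi D)
    (cnf_formula Ds).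
Proof.
elim=> [|D {}Ds linDs IH _ Dnew].
  by rewrite /(cnf_formula [::]) !big_nil; apply: extends0.
rewrite /(cnf_formula (D :: Ds)) !big_cons addnC fsetUC.
apply: extends_trans IH _; rewrite fset0U.
case: Dnew => [|[D1 [D2 [D1s D2s D12]]]]; first exact: extends_axiom.
have leD2 := linear_derivation_width linDs D2s.
apply: extendsW (extends_label leD2 D12) => //.
by rewrite fsubUset !bigfcup_sup.
Qed.

(** * From the graph to a list of distinct labels *)

Lemma linearize psi (V : finType) (E : rel V) (L : V -> xorc X) :
    subst_derivation psi E L ->
  exists2 Ds, linear_derivation psi Ds & Ds =i codom L.
Proof.
move=> [acE [src inner]].
(* Induction over vertex sets closed under predecessors, removing a sink each time. *)
suff lin n (A : {set V}) : #|A| = n ->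
    (forall u v, E u v -> v \in A -> u \in A) ->
    exists2 Ds, linear_derivation psi Ds & Ds =i [seq L v | v in A].
  have [|Ds linDs DsE] := lin _ [set: V] erefl; first by move=> *; rewrite inE.
  exists Ds => // D; rewrite DsE; apply/imageP/codomP => [[v _ ->]|[v ->]];
    by exists v; rewrite ?inE.
elim: n A => [|n IH] A An closedA.
  exists [::]; first exact: LinearNil.
  by move=> D; move/cards0_eq: An => ->; apply/esym/imageP => -[v]; rewrite inE.
have [v0 v0A] : exists v, v \in A by apply/set0Pn; rewrite -card_gt0 An.
(* A vertex of [A] with the most ancestors has no successor in [A]: by acyclicity a successor has
   strictly more ancestors. *)
case: (arg_maxnP (fun v => #|[set u | connect E u v]|) v0A) => v; rewrite -[X in is_true X]/(v \in A) => vA vmax.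
have vNpred w : E v w -> w \notin A.
  move=> vw; apply/negP => /vmax /=; rewrite leqNgt => /negP; apply.
  apply: proper_card; apply/properP; split.
    apply/subsetP => z; rewrite !inE => zv.
    exact: connect_trans zv (connect1 vw).
  by exists w; rewrite !inE ?connect0 // acE.
have [|u w uw|Ds linDs DsE] := IH (A :\ v).
- by have := cardsD1 v A; rewrite vA An; lia.
- rewrite !inE => /andP[_ wA]; rewrite (closedA u w) // andbT.
  by apply: contraTneq wA => uv; apply: vNpred; rewrite -uv.
have memE D : (D \in [seq L u | u in A]) = (D == L v) || (D \in Ds).
  rewrite DsE; apply/imageP/predU1P.
    move=> [u uA ->]; have [->|uv] := eqVneq u v; first by left.
    by right; apply/imageP; exists u; rewrite // !inE uv.
  move=> [->|/imageP[u]]; first by exists v.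
  by rewrite !inE => /andP[_ uA] ->; exists u.
have [LvDs|LvDs] := boolP (L v \in Ds).
  by exists Ds => // D; rewrite memE; case: eqP => // ->.
exists (L v :: Ds); last by move=> D; rewrite memE inE.
apply: LinearCons => //.
have [/eqP/src ?|] := boolP ([set u | E u v] == set0); first by left.
move=> /eqP/inner[v' [v'' [_ /setP predv sub]]]; right.
have predDs u : (u == v') || (u == v'') -> L u \in Ds.
  move=> uv; have {uv} Euv : E u v by have := predv u; rewrite !inE uv.
  rewrite DsE; apply/imageP; exists u; rewrite // !inE (closedA _ v) // andbT.
  by apply: contraTneq vA => uv; apply: vNpred; rewrite -{1}uv.
by exists (L v'), (L v''); split => //; apply: predDs; rewrite eqxx ?orbT.
Qed.

(** * Total cost of all labels *)

Lemma sum_label_cost (psi : seq (xorc X)) (V : finType) (L : V -> xorc X)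
    (Ds : seq (xorc X)) :
    uniq Ds -> Ds =i codom L ->
    {in Ds, forall D, #|` xvars D| <= max_width psi} ->
  \sum_(D <- Ds) label_cost psi D <=
    #|V| * 2 ^ (max_width psi).-1 + tight_refutation psi L.
Proof.
move=> uDs DsE leDs; set n := #|V|.
have szE : size Ds = size (undup (codom L)).
  apply/perm_size/uniq_perm => //; first exact: undup_uniq.
  by move=> D; rewrite mem_undup DsE.
have leV : size Ds <= n by rewrite szE -[n](size_codom L) size_undup.
have [m2|m2] := eqVneq (max_width psi) 2; last first.
  rewrite (eq_bigr (fun=> 2 ^ (max_width psi).-1)); last first.
    by move=> D _; rewrite /label_cost m2.
  rewrite big_const_seq count_predT iter_addn_0 mulnC.
  by rewrite (leq_trans (leq_mul leV (leqnn _))) ?leq_addr.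
rewrite {1}m2 expn1; rewrite m2 in leDs.
set c := label_cost psi.
have c_le D : #|` xvars D| <= 2 ->
    c D <= 2 + ((xbot X \notin psi) && (D == xbot X)).
  move=> leD; rewrite /c /label_cost m2 /= andbC; case: ifP => _ //.
  by rewrite addn0 -[X in _ <= X]expn1 leq_exp2l //; lia.
(* Stated for sublists because it is applied again below after removing a cheap label. Uniqueness
   lets the contradiction contribute its extra clause only once. *)
have sum_le (Ds' : seq (xorc X)) : uniq Ds' -> {subset Ds' <= Ds} ->
    \sum_(D <- Ds') c D <=
      size Ds' * 2 + ((xbot X \notin psi) && (xbot X \in Ds')).
  elim: Ds' => [|D Ds' IH] /=; first by rewrite big_nil.
  move=> /andP[DDs' uDs'] sub; rewrite big_cons.
  have sub' : {subset Ds' <= Ds} by move=> D' D's; rewrite sub // mem_behead.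
  have leD := leDs D (sub D (mem_head _ _)).
  apply: leq_trans (leq_add (c_le D leD) (IH uDs' sub')) _.
  rewrite inE eq_sym; case: eqVneq => [->|_] /=.
    by rewrite (negbTE DDs'); case: (_ \notin psi) => /=; lia.
  by move: (_ \notin psi) (_ \in Ds') => [] [] /=; lia.
have := sum_le Ds uDs (fun=> id).
have [/andP[Bpsi BDs]|_] := boolP (_ && _); last by lia.
move=> le_total.
(* A repeated label leaves two clauses of slack; otherwise [L] is injective. *)
have [ltV|geV] := ltnP (size Ds) n; first by lia.
have injL : injectiveb L.
  by rewrite -[injectiveb L]negbK -ltn_size_undup -szE -leqNgt size_map -cardE.
have [tight|] := boolP [forall v, (L v == xbot X) || (#|` xvars (L v)| == 2)].
  suff -> : tight_refutation psi L by move: le_total; rewrite /=; lia.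
  by rewrite /tight_refutation m2 Bpsi injL tight -DsE BDs.
case/forallPn => v; rewrite negb_or => /andP[vB vn2].
have LvDs : L v \in Ds by rewrite DsE codom_f.
have := sum_le (rem (L v) Ds) (rem_uniq _ uDs) (@mem_rem _ _ _).
(* Such a label has width 0 or 1, and the truncated exponent is 0 in both cases. The clause saved
   here offsets the extra one for the contradiction. *)
rewrite size_rem //; have : c (L v) = 1.
  rewrite /c /label_cost m2 (negbTE vB) /=.
  by have /= := leDs _ LvDs; case: #|` _| vn2 => [|[|[]]].
have : 0 < size Ds by case: (Ds) LvDs.
rewrite (big_rem (L v) LvDs) /= => Ds0 -> le_rem.
apply: leq_trans (leq_add (leqnn 1) le_rem) _.
apply: (@leq_trans ((size Ds).-1.+1 * 2)).
  by rewrite mulSn addnCA [X in _ <= X]addnC leq_add2l; case: (_ && _).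
by rewrite prednK // (leq_trans (leq_mul leV (leqnn 2))) ?leq_addr.
Qed.
End Clauses.

(** * Assembly of the simulation *)

Theorem theorem1 (X : choiceType) (psi : seq (xorc X))
    (V : finType) (E : rel V) (L : V -> xorc X)
    (HG : subst_derivation psi E L) :
  exists pi : seq (clause X),
    [/\ resolution_derivation (cnf_formula psi) pi,
        forall v : V, L v <> xtop X ->
          forall C : clause X, C \in cnf (L v) -> C \in pi
      & size pi <= #|V| * 2 ^ (max_width psi).-1 + tight_refutation psi L].
Proof.
have [Ds linDs DsE] := linearize HG.
(* Starting from the empty derivation turns the number of added clauses into a bound on the
   length. *)
have [//|//|pi [der _ Dspi szpi]] := @extends_linear _ _ _ linDs [::].
exists pi; split => // [v _ C CLv|].
  apply: Dspi; apply/bigfcupP; exists (L v) => //.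
  by rewrite DsE codom_f.
apply: leq_trans szpi _; apply: sum_label_cost => //.
  exact: linear_derivation_uniq linDs.
exact: linear_derivation_width.
Qed.
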